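(* Let $G=(V,E)$ be a locally finite graph. The following are equivalent: (i) for every finite independent set $X\subseteq V$, $\#X\leq \#N(X)$; (ii) $G$ admits a surjective graph derangement.
   Context: Write $x\sim y$ if $\{x,y\}\in E$. A graph is locally finite if every vertex lies in finitely many edges (the vertex set may be infinite). For $X\subseteq V$, $N(X)=\{y\in V:\exists x\in X,\ x\sim y\}$. A subset of $V$ is independent if no two of its elements are adjacent. A graph derangement of $G$ is an injective map $f:V\to V$ with $f(v)\sim v$ for all $v\in V$; it is surjective if it is surjective as a map $V\to V$. *)

(* Defs.v *)
From mathcomp Require Import all_boot.
From mathcomp Require Import boolp classical_sets functions cardinality.

Set Implicit Arguments.
Unset Strict Implicit.
Unset Printing Implicit Defensive.

Local Open Scope classical_set_scope.

(* Simple undirected graphs on an arbitrary, possibly infinite, vertex type: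
   the edges are two-element subsets of V, so there are neither loops nor
   multiple edges. *)
Record graph (V : Type) := Graph {
  edges : set (set V);
  edges_pair : forall e, edges e -> exists x y, x <> y /\ e = [set x; y]
}.

Definition adj (V : Type) (G : graph V) (x y : V) : Prop :=
  edges G [set x; y].

Definition locally_finite (V : Type) (G : graph V) : Prop :=
  forall v, finite_set [set e | edges G e /\ e v].

(* N(X) may meet X. *)
Definition neighborhood (V : Type) (G : graph V) (X : set V) : set V :=
  [set y | exists2 x, X x & adj G x y].

Definition independent (V : Type) (G : graph V) (X : set V) : Prop :=
  forall x y, X x -> X y -> ~ adj G x y.

Definition graph_derangement (V : Type) (G : graph V) (f : V -> V) : Prop :=
  injective f /\ forall v, adj G (f v) v.

Definition surjective_graph_derangement
    (V : Type) (G : graph V) (f : V -> V) : Prop :=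
  graph_derangement G f /\ set_surj [set: V] [set: V] f.

(* Main.v *)
(**
   Condition (i) gives Hall's condition for every finite set X: the part Y of X
   outside N(X) is independent, and N(Y) is disjoint from X.  The infinite
   marriage theorem, proved by Rado's argument (a minimal Hall subfamily consists
   of singletons), then yields a graph derangement f.  Each non-surjective orbit
   of f is a ray v0, v1, v2, ... starting at a vertex v0 outside the image of f;
   swapping v0 with v1, v2 with v3, and so on makes the derangement surjective.
*)
Require Import Defs.
From mathcomp Require Import all_boot.
From mathcomp Require Import boolp classical_sets functions cardinality.
From mathcomp Require Import finmap zify.

Set Implicit Arguments.
Unset Strict Implicit.
Unset Printing Implicit Defensive.

Local Open Scope classical_set_scope.

Definition hall_family (I T : choiceType) (A : I -> {fset T}) : Prop :=
  forall X : {fset I}, #|` X| <= #|` (\bigcup_(i <- X) A i)%fset|.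

Definition remove_at (I T : choiceType) (A : I -> {fset T}) (v : I) (a : T) :
  I -> {fset T} := fun i => if i == v then (A i `\ a)%fset else A i.

(** A set violating Hall's condition for the trimmed family must contain [v], because the two
    families agree at every other index. The witness [X] is that set without [v], which turns the
    strict inequality into a weak one. *)
Lemma remove_at_not_hall (I T : choiceType) (A : I -> {fset T}) (v : I) (a : T) :
  hall_family A -> ~ hall_family (remove_at A v a) ->
  exists2 X : {fset I}, v \notin X &
    #|` ((A v `\ a) `|` \bigcup_(i <- X) A i)%fset| <= #|` X|.
Proof.
move=> hA /existsNP[X /negP]; rewrite -ltnNge => ltX.
have sub (Y : {fset I}) : v \notin Y ->
    (\bigcup_(i <- Y) A i = \bigcup_(i <- Y) remove_at A v a i)%fset.
  move=> vY; apply: eq_big_seq => i iY; rewrite /remove_at.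
  by case: eqP => // iv; rewrite -iv iY in vY.
have [vX|vX] := boolP (v \in X); last first.
  by have := hA X; rewrite sub // leqNgt ltX.
exists (X `\ v)%fset; first by rewrite !inE eqxx.
move: ltX; rewrite (cardfsD1 v X) vX add1n ltnS; apply: leq_trans.
apply: fsubset_leq_card; rewrite sub ?inE ?eqxx //.
rewrite fsubUset; apply/andP; split.
  have := @bigfcup_sup _ _ X v predT (remove_at A v a) vX isT.
  by rewrite {1}/remove_at eqxx.
apply/bigfcupsP => i; rewrite !inE => /andP[_ iX] _.
exact: (@bigfcup_sup _ _ X i predT).
Qed.

(* Rado's step: the two violating sets X and Y would contradict the
   submodularity of X |-> #|A(X)|. *)
Lemma hall_remove (I T : choiceType) (A : I -> {fset T}) (v : I) (a b : T) :
  hall_family A -> a != b ->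
  hall_family (remove_at A v a) \/ hall_family (remove_at A v b).
Proof.
move=> hA ab; apply: contrapT => /not_orP[].
move=> /(remove_at_not_hall hA)[X vX leX] /(remove_at_not_hall hA)[Y vY leY].
set P := (_ `|` _)%fset in leX; set Q := (_ `|` _)%fset in leY.
(* All of [A v] is covered: [P] misses at most [a], which survives the removal of [b] in [Q]. *)
have leU : #|` (v |` (X `|` Y))%fset| <= #|` (P `|` Q)%fset|.
  apply: leq_trans (hA _) (fsubset_leq_card _).
  apply/bigfcupsP => i /[!inE] iU _; apply/fsubsetP => y yi.
  have inA (Z : {fset I}) : i \in Z -> y \in (\bigcup_(j <- Z) A j)%fset.
    by move=> iZ; apply/bigfcupP; exists i; rewrite ?iZ.
  rewrite /P /Q !inE; case/or3P: iU => [/eqP iv|/inA ->|/inA ->]; last 2 first.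
  - by rewrite orbT.
  - by rewrite !orbT.
  by rewrite -iv yi !andbT; case: (eqVneq y a) => [->|]; rewrite ?ab ?orbT.
have leI : #|` (X `&` Y)%fset| <= #|` (P `&` Q)%fset|.
  apply: leq_trans (hA _) (fsubset_leq_card _).
  apply/bigfcupsP => i /[!inE] /andP[iX iY] _; apply/fsubsetP => y yi.
  rewrite /P /Q !inE; apply/andP; split; apply/orP; right;
    by apply/bigfcupP; exists i; rewrite ?iX ?iY.
move: leU; rewrite cardfsU1 !inE (negbTE vX) (negbTE vY) /= => leU.
(* As [v] lies outside both [X] and [Y], the sum of [leU] and [leI] is #|X| + #|Y| + 1 <= #|P| +
   #|Q|, against [leX] and [leY]. *)
have := cardfsUI P Q; have := cardfsUI X Y; lia.
Qed.

(** Zorn's lemma applies because the sets are finite: this lets Hall's condition pass to the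
    intersection of a chain of subfamilies. *)
Lemma hall_minimal (I T : choiceType) (N : I -> {fset T}) :
  hall_family N ->
  exists2 A : I -> {fset T},
    hall_family A /\ (forall i, A i `<=` N i)%fset &
    forall B, hall_family B -> (forall i, B i `<=` A i)%fset -> B = A.
Proof.
move=> hN.
pose P A := hall_family A /\ (forall i, A i `<=` N i)%fset.
(* The order is reversed inclusion, so that maximal elements are minimal families. *)
pose R (s t : {A | P A}) := `[< forall i, (sval t i `<=` sval s i)%fset >].
have Rrefl t : R t t by apply/asboolP => i; exact: fsubset_refl.
have Rtrans r s t : R r s -> R s t -> R r t.
  move=> /asboolP rs /asboolP st; apply/asboolP => i.
  exact: fsubset_trans (st i) (rs i).
have Ranti s t : R s t -> R t s -> s = t.
  case: s t => [A PA] [B PB] /asboolP/= BA /asboolP/= AB.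
  by apply/eq_exist/funext => i; apply/eqP; rewrite eqEfsubset AB BA.
have [C totC|[A [hA AN]] minA] := Zorn Rrefl Rtrans Ranti; last first.
  exists A => // B hB BA.
  have PB : P B by split=> // i; exact: fsubset_trans (BA i) (AN i).
  have RB : R (exist _ A (conj hA AN)) (exist _ B PB) by exact/asboolP.
  by have /(congr1 sval) := minA _ RB.
have [[t0 Ct0]|C0] := pselect (exists t, C t); last first.
  have PN : P N by split=> // i; exact: fsubset_refl.
  by exists (exist _ N PN) => s Cs; case: C0; exists s.
(* In a chain, a member with the fewest elements at [i] is contained at [i] in every other
   member. *)
have minC i : exists t, C t /\ forall s, C s -> (sval t i `<=` sval s i)%fset.
  pose card_at n := `[< exists2 t, C t & #|` sval t i| = n >].
  have ex_n : exists n, card_at n.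
    by exists #|` sval t0 i|; apply/asboolP; exists t0.
  case: (ex_minnP ex_n) => n /asboolP[t Ct tn] min_n; exists t; split=> // s Cs.
  have [/asboolP/(_ i) //|/asboolP/(_ i) st] := totC _ _ Cs Ct.
  have /eqP -> : sval s i == sval t i; last exact: fsubset_refl.
  rewrite eqEfcard st tn min_n //.
  by apply/asboolP; exists s.
have [m mP] := choice minC.
pose B i := sval (m i) i.
(* A chain attains its pointwise intersection simultaneously on a finite set. *)
have attained (X : {fset I}) :
    exists2 t, C t & forall i, i \in X -> (sval t i `<=` B i)%fset.
  elim/fset1U_rect: X => [|x X _ [t Ct tB]]; first by exists t0.
  have [Cm _] := mP x.
  have [/asboolP tm|/asboolP mt] := totC _ _ Ct Cm.
    exists (m x) => // i /fset1UP[->|iX]; first exact: fsubset_refl.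
    exact: fsubset_trans (tm i) (tB i iX).
  by exists t => // i /fset1UP[->|/tB //]; exact: mt.
have PB : P B.
  split=> [X|i]; last by case: (svalP (m i)) => _; apply.
  have [t _ tB] := attained X; have [ht _] := svalP t.
  apply: leq_trans (ht X) (fsubset_leq_card _).
  apply/bigfcupsP => i iX _; apply: fsubset_trans (tB i iX) _.
  exact: (@bigfcup_sup _ _ X i predT B).
exists (exist _ B PB) => s Cs; apply/asboolP => i /=.
by have [_] := mP i; apply.
Qed.

(** In a minimal Hall family no set has two elements, since [hall_remove] would delete one of them.
    Hall's condition on one index makes the sets nonempty, and on two indices makes them
    distinct. *)
Lemma marriage (I T : choiceType) (N : I -> {fset T}) :
  hall_family N -> exists2 f : I -> T, injective f & forall i, f i \in N i.
Proof.
move=> /hall_minimal[A [hA AN] minA].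
have sub1 i a b : a \in A i -> b \in A i -> a = b.
  move=> ai bi; apply/eqP/negPn/negP => ab.
  have sub_rem c : c \in A i -> ~ hall_family (remove_at A i c).
    move=> ci /minA eqA; have : remove_at A i c = A.
      apply: eqA => j; rewrite /remove_at; case: eqP => _;
        [exact: fsubD1set|exact: fsubset_refl].
    by move=> /(congr1 (fun F => c \in F i)); rewrite /remove_at eqxx !inE eqxx ci.
  by case: (hall_remove i hA ab); exact: sub_rem.
have ne i : exists a, a \in A i.
  have := hA [fset i]%fset; rewrite cardfs1 big_seq_fset1 cardfs_gt0.
  by move=> /fset0Pn.
have [f fA] := choice ne; exists f => [i j fij|i]; last first.
  exact: (fsubsetP (AN i)).
apply/eqP/negPn/negP => ij.
have := hA [fset i; j]%fset; rewrite cardfs2 ij leqNgt ltnS /= => /negP; apply.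
rewrite -(cardfs1 (f i)); apply: fsubset_leq_card.
apply/bigfcupsP => k /[!inE] kij _; apply/fsubsetP => y yk; rewrite inE.
case/orP: kij yk => /eqP -> yk; first by rewrite (sub1 i y (f i)).
by rewrite (sub1 j y (f j)) // fij.
Qed.

Lemma card_le_fset (T U : choiceType) (X : {fset T}) (Y : {fset U}) :
  ([set` X] #<= [set` Y])%card = (#|` X| <= #|` Y|).
Proof.
have /card_eq_fsetP eX := erefl #|` X|; have /card_eq_fsetP eY := erefl #|` Y|.
by rewrite (card_le_eql eX) (card_le_eqr eY) card_le_II.
Qed.

Section Graph.
Variables (V : Type) (G : graph V).

Lemma adj_sym (x y : V) : adj G x y -> adj G y x.
Proof. by rewrite /adj setUC. Qed.

(** Sending [y] to the edge {v, y} embeds the neighbors of [v] into the edges at [v]. *)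
Lemma finite_neighbors (v : V) :
  locally_finite G -> finite_set [set y | adj G v y].
Proof.
move=> /(_ v); apply: card_le_finite.
have inj : {in [set y | adj G v y] &, injective (fun y => [set v; y])}.
  move=> y z _ _ eq_yz.
  have : [set v; z] y by rewrite -eq_yz; right.
  have : [set v; y] z by rewrite eq_yz; right.
  by move=> [->|->] // [->|->].
rewrite -(card_le_eql (inj_card_eq inj)); apply: subset_card_le.
by move=> _ [y vy <-]; split=> //; left.
Qed.

(** [{classic V}] equips the bare type [V] with the choice structure that finite sets require.
    [fset_set] is empty on infinite sets, so the value is meaningful only when [v] has finitely many
    neighbors. *)
Definition neighbors (v : V) : {fset {classic V}} :=
  fset_set ([set y | adj G v y] : set {classic V}).

Lemma in_neighbors (v : V) (y : {classic V}) :
  locally_finite G -> (y \in neighbors v) = `[< adj G v y >].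
Proof.
move=> G_lf; rewrite /neighbors in_fset_set; last exact: finite_neighbors.
by apply/idP/asboolP => [/set_mem|/mem_set].
Qed.

Lemma neighborhood_fset (X : {fset {classic V}}) : locally_finite G ->
  neighborhood G [set` X] = [set` (\bigcup_(x <- X) neighbors x)%fset].
Proof.
move=> G_lf; apply/seteqP; split=> [y [x xX xy]|y /=].
  apply/bigfcupP; exists x; first by rewrite andbT.
  by rewrite in_neighbors //; apply/asboolP.
case/bigfcupP=> x /andP[xX _]; rewrite in_neighbors // => /asboolP xy.
by exists x.
Qed.

Lemma neighbors_hall : locally_finite G ->
  (forall X : set V, finite_set X -> independent G X ->
     (X #<= neighborhood G X)%card) ->
  hall_family (neighbors : {classic V} -> _).
Proof.
move=> G_lf indep_hall X.
pose NX := (\bigcup_(x <- X) neighbors x)%fset.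
pose Y := (X `\` NX)%fset.
have inNX x y : x \in X -> adj G x y -> y \in NX.
  move=> xX xy; apply/bigfcupP; exists x; first by rewrite xX.
  by rewrite in_neighbors //; apply/asboolP.
have indepY : independent G [set` Y].
  move=> x y /=; rewrite !inE => /andP[_ xX] /andP[yNX _] /(inNX _ _ xX) yN.
  by rewrite yN in yNX.
have leY : #|` Y| <= #|` (\bigcup_(x <- Y) neighbors x)%fset|.
  rewrite -card_le_fset -neighborhood_fset //.
  exact: indep_hall (finite_fset Y) indepY.
have : #|` (\bigcup_(x <- Y) neighbors x)%fset| <= #|` (NX `\` X)%fset|.
  apply/fsubset_leq_card/bigfcupsP => x /[!inE] /andP[xNX xX] _.
  apply/fsubsetP => y; rewrite in_neighbors // => /asboolP xy.
  rewrite inE (inNX x) // andbT; apply: contraNN xNX => yX.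
  exact: inNX yX (adj_sym xy).
(* Adding the size of the intersection of [X] and [NX] to both sides of #|Y| <= #|NX minus X| gives
   #|X| <= #|NX|. *)
have := cardfsID NX X; have := cardfsID X NX; rewrite fsetIC -/Y -/NX; lia.
Qed.

Lemma derangement_surjective (f : V -> V) :
  graph_derangement G f -> exists g, surjective_graph_derangement G g.
Proof.
move=> [f_inj f_adj].
pose ray k v := exists2 u, ~ range f u & v = iter k f u.
pose odd_ray v := exists2 k, odd k & ray k v.
have rayS k v : ray k v -> ray k.+1 (f v) by move=> [u uf ->]; exists u.
have odd_ray_ff v : odd_ray (f (f v)) -> odd_ray v.
  move=> [[|[|k]] // k_odd [u uf]] /=.
    (* Position 1 is impossible: cancelling [f] would put the starting vertex [u] in the range of
       [f]. *)
    by move=> /f_inj fvu; case: uf; exists v.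
  by move=> /f_inj/f_inj ->; exists k; [rewrite /= negbK in k_odd|exists u].
(* Odd positions on a ray step back along [f]; all other vertices, including those on cycles and
   two-way infinite orbits, step forward. *)
have /choice[g gP] v : exists w,
    odd_ray v /\ f w = v \/ ~ odd_ray v /\ w = f v.
  have [v_odd|v_even] := pselect (odd_ray v); last by exists (f v); right.
  by case: (v_odd) => -[|k] // _ [u _ vE]; exists (iter k f u); left.
exists g; split; first split=> [v w gvw|v].
- have [[v_odd fv]|[v_even gv]] := gP v; have [[w_odd fw]|[w_even gw]] := gP w.
  + by rewrite -fv -fw gvw.
  (* In the mixed cases one vertex is the image of the other under [f] twice, so both would be
     odd. *)
  + by case: w_even; apply: odd_ray_ff; rewrite -gw -gvw fv.
  + by case: v_even; apply: odd_ray_ff; rewrite -gv gvw fw.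
  + by apply: f_inj; rewrite -gv -gw.
- have [[_ fgv]|[_ ->]] := gP v; last exact: f_adj.
  by apply: adj_sym; rewrite -{1}fgv; exact: f_adj.
(* The preimage of [w] is [f w] if that is odd on a ray. Otherwise [w] is in the range, as [f w]
   would else be at position 1, and its [f]-preimage [v] is not odd, so [g v] is [w]. *)
- move=> w _; have [[_ /f_inj]|[fw_even _]] := gP (f w); first by exists (f w).
  have [[v _ fvw]|w0] := pselect (range f w); last first.
    by case: fw_even; exists 1 => //; apply: rayS; exists w.
  exists v => //; have [[[k k_odd kv] _]|[_ ->//]] := gP v.
  case: fw_even; exists k.+2; first by rewrite /= negbK.
  by rewrite -fvw; exact: rayS (rayS _ _ kv).
Qed.

End Graph.

Unset Implicit Arguments.

Theorem theorem9 (V : Type) (G : graph V) (G_lf : locally_finite G) :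
  (forall X : set V, finite_set X -> independent G X ->
     (X #<= neighborhood G X)%card) <->
  (exists f : V -> V, surjective_graph_derangement G f).
Proof.
split=> [/(neighbors_hall G_lf)/marriage[f f_inj fN]|].
  apply: (@derangement_surjective _ _ f); split=> // v.
  by apply: adj_sym; apply/asboolP; rewrite -in_neighbors.
(* Conversely, [f] itself injects [X] into its neighborhood. *)
move=> [f [[f_inj f_adj] _]] X _ _.
rewrite -(card_le_eql (inj_card_eq (in2W f_inj))); apply: subset_card_le.
by move=> _ [x Xx <-]; exists x => //; apply: adj_sym.
Qed.
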